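(* Let $\mathfrak{U}$ be a Banach algebra, let $\phi\in\Delta(\mathfrak{U})$, and suppose $\mathfrak{U}$ is $\phi$-Johnson amenable. Let $X$ be a Banach $\mathfrak{U}$-bimodule such that either $x\cdot a=\phi(a)x$ for all $a\in\mathfrak{U}$, $x\in X$, or $a\cdot x=\phi(a)x$ for all $a\in\mathfrak{U}$, $x\in X$. Then every continuous Jordan derivation from $\mathfrak{U}$ to $X$ is a derivation.
   Context: Banach algebras are complex. $\Delta(\mathfrak{U})$ is the set of all non-zero multiplicative linear functionals on $\mathfrak{U}$. For a Banach $\mathfrak{U}$-bimodule $X$, the dual $X^*$ is a Banach $\mathfrak{U}$-bimodule via $\langle a\cdot f,x\rangle=\langle f,x\cdot a\rangle$ and $\langle f\cdot a,x\rangle=\langle f,a\cdot x\rangle$. The projective tensor product $\mathfrak{U}\widehat{\otimes}\mathfrak{U}$ is a Banach $\mathfrak{U}$-bimodule via $a\cdot(b\otimes c)=ab\otimes c$ and $(b\otimes c)\cdot a=b\otimes ca$; $\pi:\mathfrak{U}\widehat{\otimes}\mathfrak{U}\to\mathfrak{U}$ is the continuous linear map with $\pi(b\otimes c)=bc$. $\mathfrak{U}$ is $\phi$-Johnson amenable if there exists $m\in(\mathfrak{U}\widehat{\otimes}\mathfrak{U})^{**}$ such that $a\cdot m=m\cdot a$ for every $a\in\mathfrak{U}$ and $\tilde\phi\circ\pi^{**}(m)=1$, where $\tilde\phi(F)=F(\phi)$ for $F\in\mathfrak{U}^{**}$. A linear map $\delta:\mathfrak{U}\to X$ is a derivation if $\delta(ab)=\delta(a)\cdot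 b+a\cdot\delta(b)$ for all $a,b\in\mathfrak{U}$, and a Jordan derivation if $\delta(a\circ b)=\delta(a)\circ b+a\circ\delta(b)$ for all $a,b\in\mathfrak{U}$, where $a\circ b=ab+ba$ and $a\circ x=x\circ a=a\cdot x+x\cdot a$ for $a,b\in\mathfrak{U}$, $x\in X$. *)

(* Defs.v *)
From HB Require Import structures.
From mathcomp Require Import all_boot all_order all_algebra complex.
From mathcomp Require Import all_classical all_reals all_analysis.
From mathcomp Require Import ring.
Set Implicit Arguments.
Unset Strict Implicit.
Unset Printing Implicit Defensive.
Import Order.TTheory GRing.Theory Num.Theory numFieldNormedType.Exports.
Local Open Scope classical_set_scope.
Local Open Scope ring_scope.

(* In a normed space over [R[i]] the norm is a nonnegative real element of
   [R[i]]; [rnorm] is the same number in [R]. *)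
Definition rnorm (R : realType) (V : normedModType R[i]) (x : V) : R :=
  complex.Re `|x|.

Lemma rnormE (R : realType) (V : normedModType R[i]) (x : V) :
  `|x| = (rnorm x)%:C%C.
Proof.
rewrite /rnorm; have := normr_ge0 x.
by case: `|x| => a b; rewrite lecE /= => /andP[/eqP-> _].
Qed.

Lemma rnorm_ge0 (R : realType) (V : normedModType R[i]) (x : V) : 0 <= rnorm x.
Proof. by rewrite -lecR -rnormE; exact: normr_ge0. Qed.

Section BoundedOperators.
Variables (R : realType) (E F : normedModType R[i]).

Definition bop_pred : {pred (E -> F)} :=
  fun f => `[< linear f /\ continuous f >].

Record bop := Bop { bop_fun :> E -> F; bop_funP : bop_fun \in bop_pred }.

HB.instance Definition _ := [isSub for bop_fun].
HB.instance Definition _ := gen_eqMixin bop.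
HB.instance Definition _ := gen_choiceMixin bop.

Lemma bop_linear (f : bop) : linear f.
Proof. by have /asboolP[] := bop_funP f. Qed.

Lemma bop_continuous (f : bop) : continuous f.
Proof. by have /asboolP[] := bop_funP f. Qed.

HB.instance Definition _ (f : bop) :=
  GRing.isLinear.Build R[i] E F *:%R (bop_fun f) (bop_linear f).

Lemma bopP (f g : bop) : (forall x, f x = g x) -> f = g.
Proof. by move=> fg; apply: val_inj; apply/funext. Qed.

Lemma bop_submod_closed : submod_closed bop_pred.
Proof.
split.
  apply/asboolP; split; last exact: cst_continuous.
  by move=> a x y; rewrite scaler0 addr0.
move=> a f g /asboolP[lf cf] /asboolP[lg cg]; apply/asboolP; split.
  move=> b x y /=; rewrite !fctE /=.
  rewrite lf lg !scalerDr !scalerA mulrC addrACA; congr (_ + _).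
by move=> x; apply: continuousD; [apply: continuousZl_tmp; exact: cf|exact: cg].
Qed.

HB.instance Definition _ :=
  GRing.isSubmodClosed.Build _ _ bop_pred bop_submod_closed.
HB.instance Definition _ := [SubChoice_isSubLmodule of bop by <:].

Definition opnorm (f : bop) : R :=
  sup [set rnorm (f x) | x in [set x : E | rnorm x <= 1]].

Lemma bop_bounded (f : bop) :
  exists2 M : R, 0 <= M & forall x, rnorm (f x) <= M * rnorm x.
Proof.
have /linear_boundedP := continuous_linear_bounded 0 (@bop_continuous f 0).
move=> /pinfty_ex_gt0[M M0 Mf].
have M_E : M = (complex.Re M)%:C%C.
  by move: M0 {Mf}; case: M => a b; rewrite ltcE /= => /andP[/eqP-> _].
exists (complex.Re M); first by rewrite -lecR -M_E ltW.
move=> x; rewrite -lecR rmorphM/= -M_E -!rnormE; exact: Mf.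
Qed.

Lemma opnormP (f : bop) x : rnorm (f x) <= opnorm f * rnorm x.
Proof.
have [M M0 Mf] := bop_bounded f.
have [->|x0] := eqVneq x 0.
  by rewrite /rnorm linear0 !normr0 /= mulr0.
have nx0 : 0 < rnorm x by rewrite -ltcR -rnormE normr_gt0.
have rnZ (V : normedModType R[i]) (k : R) (v : V) : 0 <= k ->
    rnorm (k%:C%C *: v) = k * rnorm v.
  move=> k0; apply/(@complexI R); rewrite -rnormE normrZ rmorphM/= -rnormE.
  by rewrite ger0_norm// -(rmorph0 (real_complex R)) lecR.
have inx : 0 <= (rnorm x)^-1 by rewrite invr_ge0 ltW.
rewrite -ler_pdivrMr// mulrC -(rnZ _ _ _ inx).
rewrite /opnorm; apply: ub_le_sup.
  exists M => _ [y /= y1 <-]; apply: (le_trans (Mf y)).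
  by rewrite ler_piMr.
exists ((rnorm x)^-1%:C%C *: x) => /=.
  by rewrite (rnZ _ _ _ inx) mulVf ?gt_eqF.
by rewrite linearZ.
Qed.

Lemma opnorm_ge0 (f : bop) : 0 <= opnorm f.
Proof.
have [M M0 Mf] := bop_bounded f.
have <- : rnorm (f 0) = 0 by rewrite /rnorm linear0 normr0.
rewrite /opnorm; apply: ub_le_sup.
  exists M => _ [y /= y1 <-]; apply: (le_trans (Mf y)).
  by rewrite ler_piMr.
by exists 0 => //=; rewrite /rnorm normr0 ler01.
Qed.

Lemma opnorm_le (f : bop) (M : R) : 0 <= M ->
  (forall x, rnorm (f x) <= M * rnorm x) -> opnorm f <= M.
Proof.
move=> M0 Mf; apply: ge_sup.
  by exists (rnorm (f 0)), 0 => //=; rewrite /rnorm normr0 ler01.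
by move=> _ [y /= y1 <-]; apply: (le_trans (Mf y)); rewrite ler_piMr.
Qed.

Let bop_norm (f : bop) : R[i] := (opnorm f)%:C%C.

Let bop_normD (f g : bop) : bop_norm (f + g) <= bop_norm f + bop_norm g.
Proof.
rewrite /bop_norm -rmorphD lecR; apply: opnorm_le.
  by rewrite addr_ge0// opnorm_ge0.
move=> x; rewrite mulrDl -lecR -rnormE rmorphD/=.
apply: (le_trans (ler_normD _ _)).
by rewrite !rnormE lerD// lecR opnormP.
Qed.

Let bop_normZ_le (a : R[i]) (f : bop) :
  bop_norm (a *: f) <= `|a| * bop_norm f.
Proof.
have aE := @rnormE R R[i]^o a.
rewrite /bop_norm aE -rmorphM lecR; apply: opnorm_le.
  by rewrite mulr_ge0 ?opnorm_ge0// rnorm_ge0.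
move=> x; rewrite -mulrA -lecR -rnormE rmorphM/= -aE.
by rewrite [leLHS]normrZ ler_wpM2l// rnormE lecR opnormP.
Qed.

Let bop_normZ (a : R[i]) (f : bop) : bop_norm (a *: f) = `|a| * bop_norm f.
Proof.
apply/le_anti; rewrite bop_normZ_le/=.
have [->|a0] := eqVneq a 0.
  by rewrite normr0 mul0r /bop_norm -(rmorph0 (real_complex R)) lecR opnorm_ge0.
rewrite -ler_pdivlMl ?normr_gt0// -normfV.
by apply: le_trans (bop_normZ_le _ _); rewrite scalerA mulVf// scale1r.
Qed.

Let bop_norm_eq0 (f : bop) : bop_norm f = 0 -> f = 0.
Proof.
move=> /complexI f0; apply: bopP => x; apply/eqP.
by rewrite -normr_eq0 rnormE eq_le -(rmorph0 (real_complex R)) !lecR rnorm_ge0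
  andbT (le_trans (opnormP f x))// f0 mul0r.
Qed.

HB.instance Definition _ :=
  Lmodule_isNormed.Build R[i] bop bop_normD bop_normZ bop_norm_eq0.

End BoundedOperators.

Section BoundedOperatorTheory.
Variables (R : realType) (E F : normedModType R[i]).

Definition bounded_map (f : E -> F) :=
  exists2 M : R[i], 0 <= M & forall x, `|f x| <= M * `|x|.

Lemma ge0_realE (M : R[i]) : 0 <= M -> M = (complex.Re M)%:C%C.
Proof. by case: M => a b; rewrite lecE /= => /andP[/eqP-> _]. Qed.

Lemma bop_le (f : bop E F) x : `|f x| <= `|f| * `|x|.
Proof.
by rewrite (_ : `|f| = (opnorm f)%:C%C)// !rnormE -rmorphM lecR opnormP.
Qed.

Lemma bop_norm_le (f : bop E F) (M : R[i]) : 0 <= M ->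
  (forall x, `|f x| <= M * `|x|) -> `|f| <= M.
Proof.
move=> M0; rewrite (ge0_realE M0) => Mf.
rewrite (_ : `|f| = (opnorm f)%:C%C)// lecR; apply: opnorm_le.
  by rewrite -lecR -ge0_realE.
by move=> x; rewrite -lecR rmorphM/= -!rnormE.
Qed.

Lemma bounded_map_bop (f : E -> F) : linear f -> bounded_map f ->
  f \in @bop_pred R E F.
Proof.
move=> lf [M M0 Mf]; apply/asboolP; split => //.
pose fl := GRing.isLinear.Build R[i] E F *:%R f lf.
pose g : {linear E -> F} := HB.pack f fl.
apply: (@bounded_linear_continuous _ _ _ g); apply/linear_boundedP.
near=> r => x; apply: (le_trans (Mf x)); rewrite ler_wpM2r//.
by near: r; apply: nbhs_pinfty_ge; apply: ger0_real.
Unshelve. all: by end_near. Qed.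

Definition mk_bop (f : E -> F) (lf : linear f) (bf : bounded_map f) :
  bop E F := Bop (bounded_map_bop lf bf).

End BoundedOperatorTheory.

Lemma bop_comp_linear (R : realType) (E F G : normedModType R[i])
  (g : bop F G) (f : bop E F) : linear (g \o f).
Proof. by move=> a x y /=; rewrite !linearP. Qed.

Lemma bop_comp_bounded (R : realType) (E F G : normedModType R[i])
  (g : bop F G) (f : bop E F) : bounded_map (g \o f).
Proof.
exists (`|g| * `|f|); first by rewrite mulr_ge0.
move=> x /=; rewrite -mulrA; apply: (le_trans (bop_le _ _)).
by rewrite ler_wpM2l// bop_le.
Qed.

Definition bop_comp (R : realType) (E F G : normedModType R[i])
    (g : bop F G) (f : bop E F) : bop E G :=
  mk_bop (bop_comp_linear g f) (bop_comp_bounded g f).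

Notation dual R E := (@bop R E (GRing.regular (complex R))).

Section Adjoint.
Variables (R : realType) (E F : normedModType R[i]) (T : bop E F).

Let adj (f : dual R F) : dual R E := bop_comp f T.

Let adj_linear : linear adj.
Proof. by move=> a f g; apply: bopP => x. Qed.

Let adj_bounded : bounded_map adj.
Proof.
exists `|T| => // f; apply: bop_norm_le; first by rewrite mulr_ge0.
move=> x /=; apply: (le_trans (bop_le _ _)).
by rewrite (mulrC `|T|) -mulrA ler_wpM2l// bop_le.
Qed.

Definition adjoint : bop (dual R F) (dual R E) :=
  mk_bop adj_linear adj_bounded.

End Adjoint.

HB.mixin Record isBanachAlgebra (K : numFieldType) A
    of CompleteNormedModule K A := {
  bamul : {bilinear A -> A -> A} ;
  bamulA : forall a b c, bamul a (bamul b c) = bamul (bamul a b) c ;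
  bamul_norm : forall a b, `|bamul a b| <= `|a| * `|b|
}.

#[short(type="banachAlgType")]
HB.structure Definition BanachAlgebra (K : numFieldType) :=
  {A of isBanachAlgebra K A & CompleteNormedModule K A}.

(* No unit is assumed, and the actions need not be contractive. *)
Record bimodule (R : realType) (A : banachAlgType R[i])
    (X : normedModType R[i]) := Bimodule {
  lact : {bilinear A -> X -> X} ;
  ract : {bilinear X -> A -> X} ;
  lactM : forall a b x, lact (bamul a b) x = lact a (lact b x) ;
  ractM : forall x a b, ract x (bamul a b) = ract (ract x a) b ;
  lractA : forall a x b, ract (lact a x) b = lact a (ract x b) ;
  lact_bounded : exists2 M : R[i], 0 <= M &
    forall a x, `|lact a x| <= M * `|a| * `|x| ;
  ract_bounded : exists2 M : R[i], 0 <= M &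
    forall x a, `|ract x a| <= M * `|x| * `|a|
}.

Section DualBimodule.
Variables (R : realType) (A : banachAlgType R[i]) (X : normedModType R[i]).
Variable B : bimodule A X.

Let lact_bop_bounded a : bounded_map (lact B a).
Proof.
have [M M0 Mf] := lact_bounded B; exists (M * `|a|) => //.
by rewrite mulr_ge0.
Qed.

Let ract_bop_bounded a : bounded_map ((ract B)^~ a).
Proof.
have [M M0 Mf] := ract_bounded B; exists (M * `|a|).
  by rewrite mulr_ge0.
by move=> x; rewrite mulrAC.
Qed.

Let lact_linear a : linear (lact B a).
Proof. by move=> k x y; rewrite linearPr. Qed.

Let ract_linear a : linear ((ract B)^~ a).
Proof. by move=> k x y; rewrite linearPl. Qed.

Definition lact_bop a : bop X X := mk_bop (@lact_linear a) (lact_bop_bounded a).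
Definition ract_bop a : bop X X := mk_bop (@ract_linear a) (ract_bop_bounded a).

(* <a . f, x> = <f, x . a> and <f . a, x> = <f, a . x> *)
Definition dual_lact (a : A) (f : dual R X) : dual R X :=
  adjoint (ract_bop a) f.
Definition dual_ract (f : dual R X) (a : A) : dual R X :=
  adjoint (lact_bop a) f.

Lemma dual_lact_bilinear : bilinear_for *:%R *:%R dual_lact.
Proof.
split=> [f|a] k x y; last by rewrite /dual_lact linearP.
by apply: bopP => z /=; rewrite linearPr linearP.
Qed.

Lemma dual_ract_bilinear : bilinear_for *:%R *:%R dual_ract.
Proof.
split=> [a|f] k x y; first by rewrite /dual_ract linearP.
by apply: bopP => z /=; rewrite linearPl linearP.
Qed.

HB.instance Definition _ :=
  bilinear_isBilinear.Build _ _ _ _ _ _ dual_lact dual_lact_bilinear.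
HB.instance Definition _ :=
  bilinear_isBilinear.Build _ _ _ _ _ _ dual_ract dual_ract_bilinear.

Let dual_lactM a b f :
  dual_lact (bamul a b) f = dual_lact a (dual_lact b f).
Proof. by apply: bopP => x /=; rewrite ractM. Qed.

Let dual_ractM f a b :
  dual_ract f (bamul a b) = dual_ract (dual_ract f a) b.
Proof. by apply: bopP => x /=; rewrite lactM. Qed.

Let dual_lractA a f b :
  dual_ract (dual_lact a f) b = dual_lact a (dual_ract f b).
Proof. by apply: bopP => x /=; rewrite lractA. Qed.

Let dual_lact_bounded : exists2 M : R[i], 0 <= M &
  forall a f, `|dual_lact a f| <= M * `|a| * `|f|.
Proof.
have [M M0 Mf] := ract_bounded B; exists M => // a f.
apply: bop_norm_le; first by rewrite !mulr_ge0.
move=> x /=; apply: (le_trans (bop_le _ _)).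
rewrite [leRHS](_ : _ = `|f| * (M * `|x| * `|a|)); last by ring.
by rewrite ler_wpM2l.
Qed.

Let dual_ract_bounded : exists2 M : R[i], 0 <= M &
  forall f a, `|dual_ract f a| <= M * `|f| * `|a|.
Proof.
have [M M0 Mf] := lact_bounded B; exists M => // f a.
apply: bop_norm_le; first by rewrite !mulr_ge0.
move=> x /=; apply: (le_trans (bop_le _ _)).
rewrite [leRHS](_ : _ = `|f| * (M * `|a| * `|x|)); last by ring.
by rewrite ler_wpM2l.
Qed.

Definition dual_bimodule : bimodule A (dual R X) :=
  @Bimodule R A (dual R X) dual_lact dual_ract
    dual_lactM dual_ractM dual_lractA dual_lact_bounded dual_ract_bounded.

End DualBimodule.

(* The projective tensor product, given by its (isometric) universal property:
   bounded bilinear maps from [E * F] to a Banach space [Z] are the same thing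
   as bounded linear maps from the tensor product to [Z], with the same bound.
   This determines the space up to isometric isomorphism compatible with
   [ptens]. *)
Record proj_tensor (R : realType) (E F : completeNormedModType R[i]) :=
  ProjTensor {
    ptens_space :> completeNormedModType R[i] ;
    ptens : {bilinear E -> F -> ptens_space} ;
    ptens_norm : forall x y, `|ptens x y| <= `|x| * `|y| ;
    ptens_lift : forall (Z : completeNormedModType R[i])
        (B : {bilinear E -> F -> Z}) (M : R[i]), 0 <= M ->
      (forall x y, `|B x y| <= M * `|x| * `|y|) ->
      exists2 L : bop ptens_space Z, `|L| <= M &
        forall x y, L (ptens x y) = B x y ;
    ptens_uniq : forall (Z : completeNormedModType R[i])
        (L L' : bop ptens_space Z),
      (forall x y, L (ptens x y) = L' (ptens x y)) -> L = L'
  }.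

Section TensorBimodule.
Variables (R : realType) (A : banachAlgType R[i]) (T : proj_tensor A A).

Let lmap (a : A) := fun b c => ptens T (bamul a b) c.
Let rmap (a : A) := fun b c => ptens T b (bamul c a).

Let lmap_bilinear a : bilinear_for *:%R *:%R (lmap a).
Proof.
split=> [c|b] k x y; last by rewrite /lmap linearPr.
by rewrite /lmap linearPr linearPl.
Qed.

Let rmap_bilinear a : bilinear_for *:%R *:%R (rmap a).
Proof.
split=> [c|b] k x y; first by rewrite /rmap linearPl.
by rewrite /rmap linearPl linearPr.
Qed.

HB.instance Definition _ a :=
  bilinear_isBilinear.Build _ _ _ _ _ _ (lmap a) (lmap_bilinear a).
HB.instance Definition _ a :=
  bilinear_isBilinear.Build _ _ _ _ _ _ (rmap a) (rmap_bilinear a).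

Lemma tensor_lact_ex (a : A) : {L : bop T T | `|L| <= `|a| /\
  forall b c, L (ptens T b c) = ptens T (bamul a b) c}.
Proof.
apply: cid; have [||L ? ?] := @ptens_lift _ _ _ T T (lmap a) `|a|.
- by [].
- move=> x y; apply: (le_trans (ptens_norm _ _ _)).
  by rewrite ler_wpM2r// bamul_norm.
- by exists L.
Qed.

Lemma tensor_ract_ex (a : A) : {L : bop T T | `|L| <= `|a| /\
  forall b c, L (ptens T b c) = ptens T b (bamul c a)}.
Proof.
apply: cid; have [||L ? ?] := @ptens_lift _ _ _ T T (rmap a) `|a|.
- by [].
- move=> x y; apply: (le_trans (ptens_norm _ _ _)).
  by rewrite (mulrC `|a|) -mulrA ler_wpM2l// (mulrC `|a|) bamul_norm.
- by exists L.
Qed.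

Lemma tensor_mul_ex : {L : bop T A | forall b c, L (ptens T b c) = bamul b c}.
Proof.
apply: cid; have [||L ? ?] := @ptens_lift _ _ _ T A bamul 1.
- by [].
- by move=> x y; rewrite mul1r bamul_norm.
- by exists L.
Qed.

(* The maps determined by a . (b (x) c) = ab (x) c, (b (x) c) . a = b (x) ca
   and pi (b (x) c) = bc. *)
Definition tensor_lact (a : A) (t : T) : T := sval (tensor_lact_ex a) t.
Definition tensor_ract (t : T) (a : A) : T := sval (tensor_ract_ex a) t.
Definition tensor_mul : bop T A := sval tensor_mul_ex.

Lemma tensor_lactE a b c :
  tensor_lact a (ptens T b c) = ptens T (bamul a b) c.
Proof. by rewrite /tensor_lact; case: tensor_lact_ex => L /= []. Qed.

Lemma tensor_ractE b c a :
  tensor_ract (ptens T b c) a = ptens T b (bamul c a).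
Proof. by rewrite /tensor_ract; case: tensor_ract_ex => L /= []. Qed.

Lemma tensor_mulE b c : tensor_mul (ptens T b c) = bamul b c.
Proof. by rewrite /tensor_mul; case: tensor_mul_ex. Qed.

Lemma tensor_lact_bilinear : bilinear_for *:%R *:%R tensor_lact.
Proof.
split=> [t|a] k x y; last by rewrite /tensor_lact linearP.
have e : sval (tensor_lact_ex (k *: x + y)) =
    k *: sval (tensor_lact_ex x) + sval (tensor_lact_ex y).
  apply: ptens_uniq => b c.
  rewrite [RHS](_ : _ = k *: tensor_lact x (ptens T b c) +
    tensor_lact y (ptens T b c))// -[LHS]/(tensor_lact _ _) !tensor_lactE.
  by rewrite !linearPl.
by rewrite /tensor_lact e.
Qed.

Lemma tensor_ract_bilinear : bilinear_for *:%R *:%R tensor_ract.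
Proof.
split=> [a|t] k x y; first by rewrite /tensor_ract linearP.
have e : sval (tensor_ract_ex (k *: x + y)) =
    k *: sval (tensor_ract_ex x) + sval (tensor_ract_ex y).
  apply: ptens_uniq => b c.
  rewrite [RHS](_ : _ = k *: tensor_ract (ptens T b c) x +
    tensor_ract (ptens T b c) y)// -[LHS]/(tensor_ract _ _) !tensor_ractE.
  by rewrite !linearPr.
by rewrite /tensor_ract e.
Qed.

HB.instance Definition _ :=
  bilinear_isBilinear.Build _ _ _ _ _ _ tensor_lact tensor_lact_bilinear.
HB.instance Definition _ :=
  bilinear_isBilinear.Build _ _ _ _ _ _ tensor_ract tensor_ract_bilinear.

Let tensor_lactM a b t :
  tensor_lact (bamul a b) t = tensor_lact a (tensor_lact b t).
Proof.
suff e : sval (tensor_lact_ex (bamul a b)) =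
    bop_comp (sval (tensor_lact_ex a)) (sval (tensor_lact_ex b)).
  by rewrite /tensor_lact e.
apply: ptens_uniq => c d; rewrite -[LHS]/(tensor_lact _ _).
rewrite -[RHS]/(tensor_lact _ (tensor_lact _ _)).
by rewrite !tensor_lactE bamulA.
Qed.

Let tensor_ractM t a b :
  tensor_ract t (bamul a b) = tensor_ract (tensor_ract t a) b.
Proof.
suff e : sval (tensor_ract_ex (bamul a b)) =
    bop_comp (sval (tensor_ract_ex b)) (sval (tensor_ract_ex a)).
  by rewrite /tensor_ract e.
apply: ptens_uniq => c d; rewrite -[LHS]/(tensor_ract _ _).
rewrite -[RHS]/(tensor_ract (tensor_ract _ _) _).
by rewrite !tensor_ractE bamulA.
Qed.

Let tensor_lractA a t b :
  tensor_ract (tensor_lact a t) b = tensor_lact a (tensor_ract t b).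
Proof.
suff e : bop_comp (sval (tensor_ract_ex b)) (sval (tensor_lact_ex a)) =
    bop_comp (sval (tensor_lact_ex a)) (sval (tensor_ract_ex b)).
  exact: (congr1 (fun L : bop T T => L t) e).
apply: ptens_uniq => c d.
rewrite -[LHS]/(tensor_ract (tensor_lact _ _) _).
rewrite -[RHS]/(tensor_lact _ (tensor_ract _ _)).
by rewrite tensor_lactE !tensor_ractE tensor_lactE.
Qed.

Let tensor_lact_bounded : exists2 M : R[i], 0 <= M &
  forall a t, `|tensor_lact a t| <= M * `|a| * `|t|.
Proof.
exists 1 => // a t; rewrite mul1r /tensor_lact.
case: tensor_lact_ex => L /= [La _]; apply: (le_trans (bop_le _ _)).
by rewrite ler_wpM2r.
Qed.

Let tensor_ract_bounded : exists2 M : R[i], 0 <= M &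
  forall t a, `|tensor_ract t a| <= M * `|t| * `|a|.
Proof.
exists 1 => // t a; rewrite mul1r mulrC /tensor_ract.
case: tensor_ract_ex => L /= [La _]; apply: (le_trans (bop_le _ _)).
by rewrite ler_wpM2r.
Qed.

Definition tensor_bimodule : bimodule A T :=
  @Bimodule R A T tensor_lact tensor_ract
    tensor_lactM tensor_ractM tensor_lractA
    tensor_lact_bounded tensor_ract_bounded.

End TensorBimodule.

(* The non-zero multiplicative linear functionals; continuity is automatic,
   see [character_bounded]. *)
Record character (R : realType) (A : banachAlgType R[i]) := Character {
  char_fun :> {linear A -> R[i]^o} ;
  charM : forall a b, char_fun (bamul a b) = char_fun a * char_fun b ;
  char_neq0 : exists a, char_fun a != 0
}.

Section CharacterTheory.
Variables (R : realType) (A : banachAlgType R[i]) (phi : character A).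

Let character_ne1 (a : A) : `|a| < 1 -> phi a <> 1.
Proof.
move=> a1 phia.
have r0 := rnorm_ge0 a; have r1 : rnorm a < 1 by rewrite -ltcR -rnormE.
pose p n := iter n (bamul a) a.
have pS n : p n.+1 = bamul a (p n) by [].
have p_le n : `|p n| <= (rnorm a ^+ n)%:C%C.
  elim: n => [|n IH]; first by rewrite expr0 ltW.
  rewrite pS (le_trans (bamul_norm _ _))// exprS rmorphM/= -rnormE.
  by rewrite ler_wpM2l.
have cp : cvgn (series p).
  apply/cauchy_cvgP/cauchy_seriesP => e e0.
  have eE := ge0_realE (ltW e0).
  have e0R : 0 < complex.Re e by rewrite -ltcR -eE.
  have : cvgn (series (geometric 1 (rnorm a))).
    by apply: is_cvg_geometric_series; rewrite ger0_norm.
  move=> /cauchy_cvgP/cauchy_seriesP/(_ _ e0R).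
  apply: filterS => -[m n] /= mn.
  rewrite eE; apply: le_lt_trans (ler_norm_sum _ _ _) _.
  apply: (@le_lt_trans _ _ (\sum_(m <= k < n) geometric 1 (rnorm a) k)%:C%C).
    rewrite rmorph_sum/=; apply: ler_sum => k _.
    by rewrite mul1r p_le.
  by rewrite ltcR; apply: le_lt_trans mn; exact: ler_norm.
have lin : linear (bamul a) by move=> k x y; rewrite linearPr.
have bdd : bounded_map (bamul a).
  by exists `|a| => // x; exact: bamul_norm.
pose l := limn (series p).
have sS n : series p n.+1 = a + bamul a (series p n).
  rewrite /series /= big_nat_recl//; congr (_ + _).
  by rewrite linear_sumr; apply: eq_bigr.
have h1 : series p n.+1 @[n --> \oo] --> l by rewrite cvg_shiftS.
have h2 : series p n.+1 @[n --> \oo] --> a + bamul a l.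
  under eq_fun do rewrite sS.
  apply: cvgD; first exact: cvg_cst.
  apply: (@cvg_comp _ _ _ (series p) (bamul a) _ _ _ cp).
  exact: (@bop_continuous _ _ _ (mk_bop lin bdd) l).
have /(congr1 (fun x => phi x)) : l = a + bamul a l by apply: cvg_unique h1 h2.
rewrite linearD charM phia mul1r => /eqP.
by rewrite eq_sym -subr_eq0 addrK oner_eq0.
Qed.

Lemma character_bounded : bounded_map phi.
Proof.
exists 1 => // a; rewrite mul1r.
have [phia0|phia0] := eqVneq (phi a) 0; first by rewrite phia0 normr0.
rewrite real_leNgt ?normr_real//; apply/negP => lt_a.
apply: (@character_ne1 ((phi a)^-1 *: a)).
  by rewrite normrZ normfV ltr_pdivrMl ?normr_gt0// mulr1.
by rewrite linearZ; exact: mulVf.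
Qed.

Let character_linear : linear phi.
Proof. by move=> k x y; rewrite linearP. Qed.

Definition character_dual : dual R A :=
  mk_bop character_linear character_bounded.

(* [adjoint (adjoint pi)] is the second adjoint of [pi].  The choice of the
   model [T] of the projective tensor product is immaterial. *)
Definition johnson_amenable : Prop :=
  exists (T : proj_tensor A A) (m : dual R (dual R T)),
    let B := dual_bimodule (dual_bimodule (tensor_bimodule T)) in
    (forall a, lact B a m = ract B m a) /\
    adjoint (adjoint (tensor_mul T)) m character_dual = 1.

End CharacterTheory.

Section Derivations.
Variables (R : realType) (A : banachAlgType R[i]) (X : normedModType R[i]).
Variables (B : bimodule A X) (d : A -> X).

Definition derivation : Prop :=
  forall a b, d (bamul a b) = ract B (d a) b + lact B a (d b).

Definition jordan_mul (a b : A) : A := bamul a b + bamul b a.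
Definition jordan_act (a : A) (x : X) : X := lact B a x + ract B x a.

Definition jordan_derivation : Prop := forall a b,
  d (jordan_mul a b) = jordan_act b (d a) + jordan_act a (d b).

End Derivations.

(* Main.v *)
(* Slicing the virtual diagonal by phi on either side, and composing the two
   slices, gives a functional E on the dual of U with E(phi) = 1 which is
   invariant under phi from the left and from the right: E(f(a .)) =
   phi(a) E(f) = E(f(. a)).  Let s be the nontrivial one of the two actions and
   f a functional on X.  Averaging the Jordan identity f(D(ab + ba)) over b
   gives f(D a) = phi(a) z(f) - z(f o s_a) - w(f, D a) with z(f) = E(f o D) and
   w(f, x) = E(b |-> f(s_b x)).  Since w(f, s_a x) = phi(a) w(f, x), the
   functional g = w(f, D .) satisfies g(ab + ba) = 2 phi(a) g(b) +
   2 phi(b) g(a), and averaging this over b gives g = 0.  So D is weakly inner,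
   hence a derivation because functionals separate the points of X. *)
Require Import Defs.
From HB Require Import structures.
From mathcomp Require Import all_boot all_order all_algebra complex.
From mathcomp Require Import all_classical all_reals all_analysis.
From mathcomp Require Import ring lra.
Import Order.TTheory GRing.Theory Num.Theory numFieldNormedType.Exports.
Local Open Scope ring_scope.

(** * Real Hahn-Banach theorem for sublinear functionals *)

Section HahnBanach.
Local Open Scope classical_set_scope.
Context {R : realType} {V : lmodType R}.
Implicit Types (p q : V -> R) (A : set (V -> R)).

Definition sublinear p :=
  (forall x y, p (x + y) <= p x + p y) /\
  (forall t x, 0 <= t -> p (t *: x) = t * p x).

(** The members of [A] need not be sublinear themselves: it is enough that each inequality holds
    after passing to another member. This covers both chains and the family defining
    [sublinear_dir]. *)
Lemma sublinear_inf A : A !=set0 ->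
  (forall x, has_lbound [set p x | p in A]) ->
  (forall p q x y, A p -> A q -> exists2 r, A r & r (x + y) <= p x + q y) ->
  (forall p t x, 0 < t -> A p -> exists2 q, A q & q (t *: x) <= t * p x) ->
  sublinear (fun x => inf [set p x | p in A]).
Proof.
move=> A0 lbA addA scaleA; set P := fun x => _.
have ne x : [set p x | p in A] !=set0 by case: A0 => p Ap; exists (p x), p.
have Ple p x : A p -> P x <= p x by move=> Ap; apply: ge_inf => //; exists p.
have leP x c : (forall p, A p -> c <= p x) -> c <= P x.
  by move=> cA; apply: lb_le_inf => // _ [p Ap <-]; exact: cA.
have Pscale t x : 0 < t -> P (t *: x) <= t * P x.
  move=> t0; rewrite mulrC -ler_pdivrMr//; apply: leP => p Ap.
  have [q Aq qp] := scaleA p t x t0 Ap.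
  by rewrite ler_pdivrMr// mulrC (le_trans (Ple _ _ Aq)).
split=> [x y|t x].
  rewrite -lerBlDr; apply: (leP x) => p Ap; rewrite lerBlDr -lerBlDl.
  apply: leP => q Aq; rewrite lerBlDl.
  have [r Ar rpq] := addA p q x y Ap Aq; exact: le_trans (Ple _ _ Ar) rpq.
rewrite le_eqVlt => /predU1P[<-|t0].
  (* The factors 2 and 1/2 give [P 0 <= 2 * P 0] and [P 0 <= P 0 / 2], which force [P 0 = 0]. *)
  rewrite scale0r mul0r; have := Pscale 2^-1 0; have := Pscale 2 0.
  by rewrite !scaler0 => /(_ ltac:(lra)) ? /(_ ltac:(lra)) ?; lra.
(* The reverse inequality is [Pscale] for the factor [t^-1] at the point [t *: x]. *)
apply/eqP; rewrite eq_le Pscale//= -ler_pdivlMl//.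
by rewrite (le_trans _ (Pscale _ (t *: x) _)) ?invr_gt0// scalerK// gt_eqF.
Qed.

Section SublinearTheory.
Context {p : V -> R} (sp : sublinear p).

Lemma sublinear0 : p 0 = 0.
Proof. by case: sp => _ /(_ 0 0 (lexx _)); rewrite scale0r mul0r. Qed.

Lemma sublinear_geN x : - p (- x) <= p x.
Proof. by have := sp.1 x (- x); rewrite subrr sublinear0; lra. Qed.

(* A sublinear functional below [p] whose value at [- y] is at most [- p y]: it
   equals [p] only if [p] is additive in the direction [y]. *)
Definition sublinear_dir (y : V) (x : V) : R :=
  inf [set q x | q in [set (fun z => p (z + t *: y) - t * p y)
    | t in [set t : R | 0 <= t]]].

Lemma sublinear_dir_has_lbound y x :
  has_lbound [set q x | q in [set (fun z => p (z + t *: y) - t * p y)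
    | t in [set t : R | 0 <= t]]].
Proof.
exists (- p (- x)) => _ [_ [t /= t0 <-] <-].
have := sp.1 (x + t *: y) (- x); rewrite addrAC subrr add0r sp.2//; lra.
Qed.

Lemma sublinear_dir_le y x t : 0 <= t ->
  sublinear_dir y x <= p (x + t *: y) - t * p y.
Proof.
move=> t0; apply: ge_inf; first exact: sublinear_dir_has_lbound.
by exists (fun z => p (z + t *: y) - t * p y) => //; exists t.
Qed.

(** Parameters [s] at [x] and [t] at [z] combine to [s + t] at [x + z]; scaling the point by [t]
    turns [s] into [t * s]. *)
Lemma sublinear_dirP y : sublinear (sublinear_dir y).
Proof.
apply: sublinear_inf.
- by eexists; exists 0 => //=.
- exact: sublinear_dir_has_lbound.
- move=> _ _ x z [s /= s0 <-] [t /= t0 <-].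
  eexists; first by exists (s + t) => //=; lra.
  have := sp.1 (x + s *: y) (z + t *: y).
  by rewrite /= addrACA -scalerDl; lra.
- move=> _ t x t0 [s /= s0 <-].
  eexists; first by exists (t * s) => //=; rewrite mulr_ge0// ltW.
  by rewrite /= -scalerA -scalerDr sp.2 ?(ltW t0)// mulrBr mulrA.
Qed.

End SublinearTheory.

(** Zorn's lemma for the reversed pointwise order: a nonempty chain is bounded by its pointwise
    infimum, the empty one by [p]. *)
Lemma minimal_sublinear p : sublinear p -> exists q, [/\ sublinear q,
  forall x, q x <= p x &
  forall r, sublinear r -> (forall x, r x <= q x) -> r = q].
Proof.
move=> sp; pose T := {q | sublinear q /\ forall x, q x <= p x}.
pose ge (q r : T) := `[< forall x, sval r x <= sval q x >].
have [] := @Zorn T ge.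
- by move=> q; apply/asboolP.
- move=> q r s /asboolP qr /asboolP rs; apply/asboolP => x.
  exact: le_trans (rs x) (qr x).
- move=> [q Pq] [r Pr] /asboolP/= qr /asboolP/= rq; apply: eq_exist.
  by apply/funext => x; apply/le_anti; rewrite rq qr.
- move=> A totA; have [->|/set0P[q0 Aq0]] := eqVneq A set0.
    by exists (exist _ p (conj sp (fun=> lexx _))).
  pose B := [set sval q | q in A].
  have lbB x : has_lbound [set q x | q in B].
    (* Any member of the chain is comparable with [q0], and [- q (- x) <= q x] for each sublinear
       [q], so one fixed [q0] bounds the whole chain from below. *)
    exists (- sval q0 (- x)) => _ [_ [q Aq <-] <-].
    case: (totA _ _ Aq Aq0) => /asboolP qq0.
      by rewrite (le_trans (sublinear_geN (svalP q0).1 x)).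
    by rewrite (le_trans _ (sublinear_geN (svalP q).1 x))// lerN2.
  have sB : sublinear (fun x => inf [set q x | q in B]).
    apply: sublinear_inf => //; first by exists (sval q0), q0.
      move=> _ _ x y [q Aq <-] [r Ar <-].
      case: (totA _ _ Aq Ar) => /asboolP qr.
        exists (sval r); first by exists r.
        by rewrite (le_trans ((svalP r).1.1 x y))// lerD2r.
      exists (sval q); first by exists q.
      by rewrite (le_trans ((svalP q).1.1 x y))// lerD2l.
    move=> _ t x t0 [q Aq <-]; exists (sval q); first by exists q.
    by rewrite (svalP q).1.2// ltW.
  have leB (q : T) x : A q -> inf [set q x | q in B] <= sval q x.
    by move=> Aq; apply: ge_inf => //; exists (sval q) => //; exists q.
  have Bp x : inf [set q x | q in B] <= p x.
    exact: le_trans (leB q0 x Aq0) ((svalP q0).2 x).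
  exists (exist _ (fun x => inf [set q x | q in B]) (conj sB Bp)) => q Aq.
  by apply/asboolP => x; exact: leB.
move=> [q [sq qp]] qmin; exists q; split=> // r sr rq.
have rp x : r x <= p x by exact: le_trans (rq x) (qp x).
apply: (congr1 sval (qmin (exist _ r (conj sr rp)) _)).
by apply/asboolP.
Qed.

(** Minimality forces [sublinear_dir y = q] for every [y]; the parameter 1 then gives
    [q x + q y <= q (x + y)]. *)
Lemma minimal_sublinear_scalar q : sublinear q ->
  (forall r, sublinear r -> (forall x, r x <= q x) -> r = q) -> scalar q.
Proof.
move=> sq qmin.
have qE y : sublinear_dir (p := q) y = q.
  apply: qmin; first exact: sublinear_dirP.
  move=> x; have := sublinear_dir_le sq y x 0 (lexx _).
  by rewrite scale0r addr0 mul0r subr0.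
have qD x y : q (x + y) = q x + q y.
  apply/le_anti; rewrite sq.1/=.
  by have := sublinear_dir_le sq y x 1 ler01; rewrite qE scale1r; lra.
have qN x : q (- x) = - q x.
  by have := qD x (- x); rewrite subrr sublinear0//; lra.
move=> t x y; rewrite qD; congr (_ + _).
have [t0|t0] := leP 0 t; first exact: sq.2.
rewrite -[t in LHS]opprK scaleNr qN sq.2; last by lra.
by rewrite mulNr opprK.
Qed.

(** The minimal functional is taken below [sublinear_dir y] instead of [p]. Its value at [- y] is
    then at most [- p y], which yields equality at [y]. *)
Lemma hahn_banach p y : sublinear p ->
  exists f : {scalar V}, (forall x, f x <= p x) /\ f y = p y.
Proof.
move=> sp; have [q [sq qp /(minimal_sublinear_scalar _ sq) lq]] :=
  minimal_sublinear _ (sublinear_dirP sp y).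
pose f : {scalar V} := HB.pack q (GRing.isLinear.Build R V R *%R q lq).
have fp x : f x <= p x.
  have := sublinear_dir_le sp y x 0 (lexx _).
  by rewrite scale0r addr0 mul0r subr0; exact: le_trans.
exists f; split=> //; apply/le_anti; rewrite fp/=.
have := sublinear_dir_le sp y (- y) 1 ler01.
rewrite scale1r addNr sublinear0// mul1r sub0r => /(le_trans (qp _)).
by rewrite -[q _]/(f _) linearN lerN2.
Qed.

End HahnBanach.

(** * Restriction to real scalars, and separation of points by the complex dual *)

Definition realified (R : realType) (V : lmodType R[i]) : Type := V.

Section Realified.
Context {R : realType} {V : lmodType R[i]}.
HB.instance Definition _ := GRing.Zmodule.on (realified R V).
Let scale (t : R) (x : realified R V) : realified R V := t%:C%C *: (x : V).
Let scaleA a b v : scale a (scale b v) = scale (a * b) v.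
Proof. by rewrite /scale scalerA -rmorphM. Qed.
Let scale1 : left_id 1 scale.
Proof. by move=> x; rewrite /scale scale1r. Qed.
Let scaleDr : right_distributive scale +%R.
Proof. by move=> t x y; rewrite /scale scalerDr. Qed.
Let scaleDl v : {morph scale^~ v : a b / a + b}.
Proof. by move=> s t; rewrite /scale rmorphD/= scalerDl. Qed.
HB.instance Definition _ := GRing.Zmodule_isLmodule.Build R (realified R V)
  scaleA scale1 scaleDr scaleDl.

End Realified.

Lemma dual_separation (R : realType) (X : normedModType R[i]) (x y : X) :
  (forall f : dual R X, f x = f y) -> x = y.
Proof.
move=> eqf; apply/eqP; rewrite -subr_eq0; apply/negPn/negP => xy0.
have sn : sublinear (fun z : realified R X => rnorm (z : X)).
  split=> [u v|t u t0].
    rewrite -lecR rmorphD/= -!rnormE; exact: ler_normD.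
  apply/(@complexI R); rewrite -rnormE normrZ rmorphM/= -rnormE.
  by rewrite ger0_norm// -(rmorph0 (real_complex R)) lecR.
(* [g] is real linear, dominated by the norm, and attains the norm at [x - y]. *)
have [g [gn gxy]] := hahn_banach (V := realified R X) _ (x - y) sn.
have gD (u v : X) : g (u + v) = g u + g v by rewrite linearD.
have gN (u : X) : g (- u) = - g u by rewrite linearN.
have gZ (t : R) (u : X) : g (t%:C%C *: u) = t * g u.
  by rewrite -[t%:C%C *: u]/(t *: (u : realified R X)) linearZ.
(* The complex linear functional with real part [g]. *)
pose f (u : X) : R[i]^o := (g u +i* - g ('i%C *: u))%C.
have fD u v : f (u + v) = f u + f v.
  by rewrite /f scalerDr !gD opprD.
have fZ a u : f (a *: u) = a *: f u.
  have aE : a = (complex.Re a)%:C%C + (complex.Im a)%:C%C * 'i%C.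
    by case: a => s t; apply/eqP; rewrite eq_complex/=; apply/andP; split;
      apply/eqP; ring.
  have gau : g (a *: u) = complex.Re a * g u + complex.Im a * g ('i%C *: u).
    by rewrite {1}aE scalerDl -scalerA gD !gZ.
  have giau : g ('i%C *: (a *: u)) =
      complex.Re a * g ('i%C *: u) - complex.Im a * g u.
    have ii (w : X) : 'i%C *: ('i%C *: w) = - w.
      by rewrite scalerA -expr2 sqr_i scaleN1r.
    rewrite {1}aE scalerDl -scalerA scalerDr gD !(scalerA 'i%C) !(mulrC 'i%C).
    by rewrite -!scalerA ii scalerN gN !gZ.
  rewrite /f gau giau; case: a {aE gau giau} => s t /=.
  by apply/eqP; rewrite eq_complex/=; apply/andP; split; apply/eqP; ring.
have lf : linear f by move=> a u v; rewrite fD fZ.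
have gnorm (u : X) : `|(g u)%:C%C| <= `|u|.
  rewrite normc_def/= expr0n addr0 sqrtr_sqr rnormE lecR ler_norml gn andbT.
  by rewrite lerNl -gN (le_trans (gn _))// /rnorm normrN.
have bf : bounded_map f.
  (* A crude bound, one for each of the real and imaginary parts; only continuity of [f] matters. *)
  exists 2 => // u.
  have -> : f u = (g u)%:C%C - 'i%C * (g ('i%C *: u))%:C%C.
    by apply/eqP; rewrite eq_complex/=; apply/andP; split; apply/eqP; ring.
  rewrite (le_trans (ler_normB _ _))// normrM mulr_natl mulr2n lerD//.
  have i1 : `|'i%C : R[i]| = 1.
    by rewrite normc_def/= expr0n expr1n add0r sqrtr1.
  by rewrite i1 mul1r (le_trans (gnorm _))// normrZ i1 mul1r.
have /eqP := eqf (mk_bop lf bf); rewrite -subr_eq0 -linearB/= eq_complex/=.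
rewrite gxy => /andP[/eqP xy_eq0 _].
by move: xy0; rewrite -normr_eq0 rnormE xy_eq0 eqxx.
Qed.

(* [ptens_uniq] needs a complete target, and [R[i]] has no such instance; the
   rank-one operators [u |-> f u *: t] have the complete target [T]. *)
Lemma ptens_dual_ext (R : realType) (E F : completeNormedModType R[i])
    (T : proj_tensor E F) (f g : dual R T) :
  (forall x y, f (ptens T x y) = g (ptens T x y)) -> f = g.
Proof.
move=> fg; apply: bopP => t.
have lt (h : dual R T) : linear (fun u => h u *: t).
  by move=> k u v; rewrite linearP scalerDl -scalerA.
have bt (h : dual R T) : bounded_map (fun u => h u *: t).
  exists (`|h| * `|t|) => [|u]; first by rewrite mulr_ge0.
  by rewrite normrZ mulrAC ler_wpM2r//; exact: (bop_le h u).
have /(congr1 (fun L : bop T T => L t)) /= :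
    mk_bop (lt f) (bt f) = mk_bop (lt g) (bt g).
  by apply: ptens_uniq => x y /=; rewrite fg.
move/eqP; rewrite -subr_eq0 -scalerBl scaler_eq0 subr_eq0.
by move=> /orP[/eqP//|/eqP->]; rewrite !linear0.
Qed.

(** * Invariant means on the dual of the algebra *)

Section Means.
Context {R : realType} {U : banachAlgType R[i]}.
Implicit Types (phi : character U) (f g : dual R U).

Let bamul_bounded : exists2 M : R[i], 0 <= M &
  forall a b : U, `|bamul a b| <= M * `|a| * `|b|.
Proof. by exists 1 => // a b; rewrite mul1r bamul_norm. Qed.

(** Through [lact_bop] and [ract_bop] this makes left and right multiplication by [a] bounded
    operators on [U]. *)
Definition regular_bimodule : bimodule U U :=
  @Bimodule R U U bamul bamul (fun a b c => esym (bamulA a b c)) bamulA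
    (fun a b c => esym (bamulA a b c)) bamul_bounded bamul_bounded.

Let lmul := lact_bop regular_bimodule.
Let rmul := ract_bop regular_bimodule.

Section Slices.
Context {phi : character U} {T : proj_tensor U U}.

Let lslice (b c : U) := phi c *: b.
Let rslice (b c : U) := phi b *: c.

Let lslice_bilinear : bilinear_for *:%R *:%R lslice.
Proof.
split=> [c|b] k x y; first by rewrite /lslice scalerDr scalerA mulrC -scalerA.
by rewrite /lslice linearP scalerDl -scalerA.
Qed.

Let rslice_bilinear : bilinear_for *:%R *:%R rslice.
Proof.
split=> [c|b] k x y; first by rewrite /rslice linearP scalerDl -scalerA.
by rewrite /rslice scalerDr scalerA mulrC -scalerA.
Qed.

HB.instance Definition _ :=
  bilinear_isBilinear.Build _ _ _ _ _ _ lslice lslice_bilinear.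
HB.instance Definition _ :=
  bilinear_isBilinear.Build _ _ _ _ _ _ rslice rslice_bilinear.

(** The slice map [id (x) phi] intertwines the left actions and turns the right action of [a] into
    multiplication by [phi a]. *)
Lemma tensor_lslice_ex :
  exists P : bop T U, forall b c, P (ptens T b c) = phi c *: b.
Proof.
have [C C0 phiC] := character_bounded phi.
have [x y|P _ PE] := @ptens_lift _ _ _ T U lslice C C0; last by exists P.
by rewrite /= /lslice normrZ mulrAC ler_wpM2r.
Qed.

Lemma tensor_rslice_ex :
  exists P : bop T U, forall b c, P (ptens T b c) = phi b *: c.
Proof.
have [C C0 phiC] := character_bounded phi.
have [x y|P _ PE] := @ptens_lift _ _ _ T U rslice C C0; last by exists P.
by rewrite /= /rslice normrZ ler_wpM2r.
Qed.

End Slices.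

(** [M] and [N] are the images of [m] under the second adjoints of the slices. Commutation with [a]
    moves the action to the tensor leg on which [phi] is evaluated, where it becomes the scalar
    [phi a]. *)
Lemma johnson_amenable_means phi : johnson_amenable phi ->
  exists M N : dual R (dual R U),
  [/\ M (character_dual phi) = 1, N (character_dual phi) = 1,
      forall a f, M (bop_comp f (lmul a)) = phi a * M f &
      forall a f, N (bop_comp f (rmul a)) = phi a * N f].
Proof.
move=> [T [m [comm_m m1]]].
have {}comm_m a (F : dual R T) :
    m (bop_comp F (lact_bop (tensor_bimodule T) a)) =
    m (bop_comp F (ract_bop (tensor_bimodule T) a)).
  exact: (congr1 (fun n : dual R (dual R T) => n F) (comm_m a)).
have {}m1 : m (bop_comp (character_dual phi) (tensor_mul T)) = 1 by [].
(* Composed with [phi], either slice equals [phi] composed with [tensor_mul], so both means take the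
   value 1 at [phi]. *)
have [P PE] := @tensor_lslice_ex phi T.
have [Q QE] := @tensor_rslice_ex phi T.
exists (adjoint (adjoint P) m), (adjoint (adjoint Q) m); split=> [||a f|a f].
- rewrite -m1; congr (m _); apply: ptens_dual_ext => b c /=.
  by rewrite PE tensor_mulE linearZ charM/= mulrC.
- rewrite -m1; congr (m _); apply: ptens_dual_ext => b c /=.
  by rewrite QE tensor_mulE linearZ charM.
- rewrite /= -[RHS]linearZ/=.
  rewrite [LHS](_ : _ = m (bop_comp (bop_comp f P)
      (lact_bop (tensor_bimodule T) a))); last first.
    congr (m _); apply: ptens_dual_ext => b c /=.
    by rewrite tensor_lactE !PE linearZr.
  rewrite comm_m; congr (m _); apply: ptens_dual_ext => b c /=.
  rewrite -[RHS]/(phi a *: f (P (ptens T b c))) tensor_ractE !PE charM mulrC.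
  by rewrite -scalerA linearZ.
- rewrite /= -[RHS]linearZ/=.
  rewrite [LHS](_ : _ = m (bop_comp (bop_comp f Q)
      (ract_bop (tensor_bimodule T) a))); last first.
    congr (m _); apply: ptens_dual_ext => b c /=.
    by rewrite tensor_ractE !QE linearZl.
  rewrite -comm_m; congr (m _); apply: ptens_dual_ext => b c /=.
  rewrite -[RHS]/(phi a *: f (Q (ptens T b c))) tensor_lactE !QE charM.
  by rewrite -scalerA linearZ.
Qed.

(** [E] is the first Arens product of [M] and [N]: [E f] is [M] in [b] of [N] in [c] of
    [f (bamul b c)]. By associativity a left translation is absorbed by [M] and a right one by
    [N]. *)
Lemma johnson_amenable_two_sided_mean phi : johnson_amenable phi ->
  exists E : dual R (dual R U),
  [/\ E (character_dual phi) = 1,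
      forall a f, E (bop_comp f (lmul a)) = phi a * E f &
      forall a f, E (bop_comp f (rmul a)) = phi a * E f].
Proof.
move=> /johnson_amenable_means[M [N [M1 N1 Ml Nr]]].
have fl_norm f a : `|bop_comp f (lmul a)| <= `|f| * `|a|.
  apply: bop_norm_le => [|b]; first by rewrite mulr_ge0.
  by rewrite (le_trans (bop_le f _))// -mulrA ler_wpM2l// bamul_norm.
pose h f (b : U) : R[i]^o := N (bop_comp f (lmul b)).
have lh f : linear (h f).
  move=> k x y; rewrite /h -linearP; congr (N _); apply: bopP => z /=.
  by rewrite linearPl linearP.
have h_norm f b : `|h f b| <= `|N| * `|f| * `|b|.
  by rewrite (le_trans (bop_le _ _))// -mulrA ler_wpM2l.
have bh f : bounded_map (h f) by exists (`|N| * `|f|) => //; rewrite mulr_ge0.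
pose H f := mk_bop (lh f) (bh f).
have lE : linear (M \o H).
  move=> k f g; rewrite /= -linearP; congr (M _); apply: bopP => b.
  by apply: (etrans _ (linearP N k _ _)); congr (N _); apply: bopP.
have bE : bounded_map (M \o H).
  exists (`|M| * `|N|) => [|f]; first by rewrite mulr_ge0.
  rewrite (le_trans (bop_le _ _))// -mulrA ler_wpM2l//.
  by apply: bop_norm_le => [|b]; [rewrite mulr_ge0|exact: h_norm].
exists (mk_bop lE bE); split=> [|a f|a f] /=.
- rewrite -M1; congr (M _); apply: bopP => b /=.
  rewrite -[RHS]mulr1 -[in RHS]N1 -[RHS]linearZ; congr (N _).
  by apply: bopP => c /=; rewrite charM.
- rewrite -Ml; congr (M _); apply: bopP => b /=.
  by congr (N _); apply: bopP => c /=; rewrite bamulA.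
- rewrite -[RHS]linearZ; congr (M _); apply: bopP => b /=.
  rewrite -[RHS]Nr; congr (N _).
  by apply: bopP => c /=; rewrite bamulA.
Qed.

(** * Jordan derivations when one of the two actions is multiplication by [phi] *)

Section JordanOneSidedAction.
Context {phi : character U} (phi_amenable : johnson_amenable phi).
Context {X : normedModType R[i]} {s : U -> X -> X}.
Hypotheses (sDl : forall x, linear (s^~ x)) (sDr : forall a, linear (s a)).
Hypothesis s_bounded : exists2 C : R[i], 0 <= C &
  forall a x, `|s a x| <= C * `|a| * `|x|.
Hypothesis sM : (forall a b x, s (bamul a b) x = s a (s b x)) \/
  (forall a b x, s (bamul a b) x = s b (s a x)).
Context {D : {linear U -> X}} (D_continuous : continuous D).
Hypothesis D_jordan : forall a b, D (bamul a b + bamul b a) =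
  (s a (D b) + phi a *: D b) + (s b (D a) + phi b *: D a).

(** Formally [D a = phi a *: z - s a z] for a point [z] of the bidual of [X]; [g] names the
    composite of [f] with [s a]. *)
Lemma jordan_weakly_inner : exists z : dual R X -> R[i],
  forall a (f g : dual R X), (forall x, g x = f (s a x)) ->
  f (D a) = phi a * z f - z g.
Proof.
have [E [E1 El Er]] := johnson_amenable_two_sided_mean _ phi_amenable.
have [C C0 sC] := s_bounded.
have lD : linear D by move=> k x y; rewrite linearP.
have pD : (D : U -> X) \in @bop_pred _ _ _ by exact/asboolP.
pose Db : bop U X := Bop pD.
have bsr x : bounded_map (s^~ x).
  by exists (C * `|x|) => [|b]; rewrite ?mulr_ge0// mulrAC.
pose sr x : bop U X := mk_bop (sDl x) (bsr x).
pose W0 (f : dual R X) (x : X) : R[i]^o := E (bop_comp f (sr x)).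
have lW (f : dual R X) : linear (W0 f).
  move=> k x y; apply: (etrans _ (linearP E k _ _)); congr (E _).
  by apply: bopP => b /=; rewrite sDr linearP.
have bW (f : dual R X) : bounded_map (W0 f).
  exists (`|E| * (`|f| * C)) => [|x]; first by rewrite !mulr_ge0.
  rewrite (le_trans (bop_le E _))// -mulrA ler_wpM2l//.
  apply: bop_norm_le => [|b]; first by rewrite !mulr_ge0.
  rewrite (le_trans (bop_le f _))// -!mulrA ler_wpM2l// [`|x| * _]mulrC mulrA.
  exact: sC.
pose W (f : dual R X) : dual R X := mk_bop (lW f) (bW f).
have ED (g h : dual R U) : E (g + h) = (E g : R[i]) + (E h : R[i]).
  exact: linearD.
have EZ k (g : dual R U) : E (k *: g) = k * (E g : R[i]) by exact: linearZ.
have WD (f : dual R X) x y : W f (x + y) = W f x + W f y by exact: linearD.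
have WZ (f : dual R X) k x : W f (k *: x) = k * W f x by exact: linearZ.
(* [s b (s a x)] is [s (bamul b a) x] for a left action and [s (bamul a b) x] for a right one, so
   the matching invariance of [E] applies. *)
have Ws (f : dual R X) a x : W f (s a x) = phi a * W f x.
  case: sM => sM'; [rewrite -[RHS](Er a (bop_comp f (sr x)))|
    rewrite -[RHS](El a (bop_comp f (sr x)))];
    by congr (E _); apply: bopP => b /=; rewrite sM'.
have WD0 (f : dual R X) a : W f (D a) = 0.
  pose g := bop_comp (W f) Db.
  have : E (bop_comp g (lmul a) + bop_comp g (rmul a)) =
      E ((2 * phi a) *: g + (2 * g a) *: character_dual phi).
    congr (E _); apply: bopP => b.
    rewrite -[LHS]/(W f (D (bamul a b)) + W f (D (bamul b a))).
    rewrite -[RHS]/((2 * phi a) * W f (D b) + (2 * W f (D a)) * phi b).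
    rewrite -WD -linearD D_jordan !WD !Ws !WZ; ring.
  (* Both sides contain [2 * phi a * E g]; what remains is [2 * g a = 0]. *)
  rewrite !ED !EZ El Er E1 -[g a]/(W f (D a)) => /eqP.
  rewrite -subr_eq0.
  rewrite [X in X == 0](_ : _ = - (2 * (W f (D a) : R[i]))); last ring.
  by rewrite oppr_eq0 mulf_eq0 pnatr_eq0/= => /eqP.
exists (fun f : dual R X => E (bop_comp f Db)) => a f g gE.
have : E (bop_comp (bop_comp f Db) (lmul a) + bop_comp (bop_comp f Db) (rmul a))
  = E (bop_comp g Db + phi a *: bop_comp f Db + bop_comp f (sr (D a)) +
       f (D a) *: character_dual phi).
  congr (E _); apply: bopP => b.
  rewrite -[LHS]/(f (D (bamul a b)) + f (D (bamul b a))).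
  rewrite -[RHS]/(g (D b) + phi a * f (D b) + f (s b (D a)) + f (D a) * phi b).
  rewrite -!linearD D_jordan !linearD !linearZ gE [f (D a) * _]mulrC.
  exact: addrA.
(* The left side is twice [phi a * z f]; one copy cancels and the [W] term vanishes. *)
rewrite !ED !EZ El Er E1 -[E (bop_comp f (sr _))]/(W f (D a)) WD0.
rewrite addr0 [X in _ = X + _]addrC -addrA => /addrI ->.
by rewrite -[(f (D a) *1 : R[i])]/(f (D a) * 1) mulr1 addrC addrK.
Qed.

End JordanOneSidedAction.
End Means.

(** * From weak innerness to the derivation identity *)

Theorem theorem4p1 (R : realType) (U : banachAlgType R[i])
    (phi : character U) (phi_amenable : johnson_amenable phi)
    (X : completeNormedModType R[i]) (B : bimodule U X)
    (actX : (forall (a : U) (x : X), ract B x a = phi a *: x) \/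
            (forall (a : U) (x : X), lact B a x = phi a *: x))
    (D : {linear U -> X}) (D_continuous : continuous D)
    (D_jordan : jordan_derivation B D) :
  derivation B D.
Proof.
case: actX => actX.
- have sM : (forall a b x, lact B (bamul a b) x = lact B a (lact B b x)) \/
    (forall a b x, lact B (bamul a b) x = lact B b (lact B a x)).
    by left; exact: lactM.
  have DJ a b : D (bamul a b + bamul b a) =
      (lact B a (D b) + phi a *: D b) + (lact B b (D a) + phi b *: D a).
    by rewrite -!actX addrC; exact: D_jordan.
  have sl x : linear (lact B ^~ x) by move=> k u v; rewrite linearPl.
  have sr a : linear (lact B a) by move=> k u v; rewrite linearPr.
  have [z zE] := jordan_weakly_inner phi_amenable sl sr (lact_bounded B) sM
    D_continuous DJ.
  move=> a b; apply: dual_separation => f.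
  (* [fab] is [f] composed with the action of [bamul a b]. Expanding all three values of [D] through
     [z], the cross terms [phi b * z fa] cancel. *)
  pose fa := bop_comp f (lact_bop B a).
  pose fab := bop_comp fa (lact_bop B b).
  have zfab := zE b fa fab (fun=> erefl).
  rewrite actX linearD linearZ/=.
  rewrite -[f (lact B a (D b))]/(fa (D b)) zfab.
  rewrite (zE a f fa (fun=> erefl)) (zE _ f fab); last first.
    by move=> x; rewrite lactM.
  by rewrite charM; change (phi a * phi b * z f - z fab =
    phi b * (phi a * z f - z fa) + (phi b * z fa - z fab) :> R[i]); ring.
- have sM : (forall a b x, ract B x (bamul a b) = ract B (ract B x b) a) \/
    (forall a b x, ract B x (bamul a b) = ract B (ract B x a) b).
    by right=> a b x; exact: ractM.
  have DJ a b : D (bamul a b + bamul b a) =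
      (ract B (D b) a + phi a *: D b) + (ract B (D a) b + phi b *: D a).
    rewrite -!actX addrC [ract B (D b) a + _]addrC [ract B (D a) b + _]addrC.
    exact: D_jordan.
  have sl x : linear (ract B x) by move=> k u v; rewrite linearPr.
  have sr a : linear (ract B ^~ a) by move=> k u v; rewrite linearPl.
  have sC : exists2 C : R[i], 0 <= C &
      forall a x, `|ract B x a| <= C * `|a| * `|x|.
    by have [C C0 BC] := ract_bounded B; exists C => // a x; rewrite mulrAC.
  have [z zE] := jordan_weakly_inner phi_amenable (s := fun a x => ract B x a)
    sl sr sC sM D_continuous DJ.
  move=> a b; apply: dual_separation => f.
  (* For the right action the factor [b] acts last, so the cancelling cross terms are now
     [phi a * z fb]. *)
  pose fb := bop_comp f (ract_bop B b).
  pose fab := bop_comp fb (ract_bop B a).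
  have zfab := zE a fb fab (fun=> erefl).
  rewrite actX linearD linearZ/=.
  rewrite -[f (ract B (D a) b)]/(fb (D a)) zfab.
  rewrite (zE b f fb (fun=> erefl)) (zE _ f fab); last first.
    by move=> x; rewrite ractM.
  by rewrite charM; change (phi a * phi b * z f - z fab =
    (phi a * z fb - z fab) + phi a * (phi b * z f - z fb) :> R[i]); ring.
Qed.
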